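(* Let $\mathbb{T}$ be a bounded time scale with $a := \min\mathbb{T}$, $b := \max\mathbb{T}$ and $a<b$. Let $L : [a,b]\times\mathbb{R}\times\mathbb{R}\to\mathbb{R}$ be a $C^1$ function, let $x_a, x_b\in\mathbb{R}$, and consider the functional $$\mathcal{L}_{\Delta}(x) = \int_a^b L\left(t,x(t),\Delta[x](t)\right)\Delta t, \qquad x\in C^1_{\mathrm{rd}}(\mathbb{T},\mathbb{R}).$$ If $\hat{x}\in C^1_{\mathrm{rd}}(\mathbb{T},\mathbb{R})$ is a (weak) local minimizer or a (weak) local maximizer of $\mathcal{L}_{\Delta}$ subject to the boundary conditions $x(a)=x_a$ and $x(b)=x_b$, then there exists a constant $c\in\mathbb{R}$ such that $$\partial_3[L]\left(t,\hat{x}(t),\Delta[\hat{x}](t)\right) = \int_a^{\sigma(t)} \partial_2[L]\left(\tau,\hat{x}(\tau),\Delta[\hat{x}](\tau)\right)\Delta\tau + c \qquad\text{for all } t\in\mathbb{T}^\kappa.$$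
   Context: A time scale $\mathbb{T}$ is a nonempty closed subset of $\mathbb{R}$, with the topology inherited from $\mathbb{R}$. The forward jump is $\sigma:\mathbb{T}\to\mathbb{T}$, $\sigma(t)=\inf\{s\in\mathbb{T}: s>t\}$, and the backward jump is $\rho:\mathbb{T}\to\mathbb{T}$, $\rho(t)=\sup\{s\in\mathbb{T}: s<t\}$, with the conventions $\inf\emptyset=\sup\mathbb{T}$ and $\sup\emptyset=\inf\mathbb{T}$ (so $\sigma(b)=b$ if $b=\max\mathbb{T}$, and $\rho(a)=a$ if $a=\min\mathbb{T}$). A point $t\in\mathbb{T}$ is left-scattered if $\rho(t)<t$; it is right-dense if $t<\sup\mathbb{T}$ and $\sigma(t)=t$, and left-dense if $t>\inf\mathbb{T}$ and $\rho(t)=t$. If $\mathbb{T}$ has a left-scattered maximum $M$, then $\mathbb{T}^\kappa:=\mathbb{T}\setminus\{M\}$; otherwise $\mathbb{T}^\kappa:=\mathbb{T}$. A function $f:\mathbb{T}\to\mathbb{R}$ is delta differentiable at $t\in\mathbb{T}^\kappa$ if there is a number $\Delta[f](t)$ (the delta derivative of $f$ at $t$) such that for every $\varepsilon>0$ there is a neighborhood $U$ of $t$ in $\mathbb{T}$ with $|f(\sigma(t))-f(s)-\Delta[f](t)(\sigma(t)-s)|\le\varepsilon|\sigma(t)-s|$ for all $s\in U$. It is delta differentiable if this holds at every $t\in\mathbb{T}^\kappa$. A function is rd-continuous if it is continuous at right-dense points and its left-sided limit exists (finite) at left-dense points. $C^1_{\mathrm{rd}}(\mathbb{T},\mathbb{R})$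 is the set of delta differentiable functions $\mathbb{T}\to\mathbb{R}$ whose delta derivative is rd-continuous (on $\mathbb{T}^\kappa$). Every rd-continuous $f$ has a delta antiderivative, i.e. a function $\xi:\mathbb{T}\to\mathbb{R}$ with $\Delta[\xi]=f$ on $\mathbb{T}^\kappa$, and the delta integral is defined by $\int_c^d f(t)\,\Delta t=\xi(d)-\xi(c)$ for $c,d\in\mathbb{T}$. $\partial_i[L]$ denotes the partial derivative of $L$ with respect to its $i$th variable, for $L=L(t,x,v)$. A function $\hat{x}\in C^1_{\mathrm{rd}}(\mathbb{T},\mathbb{R})$ is a (weak) local minimizer (respectively, maximizer) of $\mathcal{L}_\Delta$ subject to $x(a)=x_a$, $x(b)=x_b$ if $\hat{x}(a)=x_a$, $\hat{x}(b)=x_b$, and there is $\delta>0$ such that $\mathcal{L}_\Delta(\hat{x})\le\mathcal{L}_\Delta(x)$ (respectively, $\ge$) for all $x\in C^1_{\mathrm{rd}}(\mathbb{T},\mathbb{R})$ with $x(a)=x_a$, $x(b)=x_b$ and $\sup_{t\in\mathbb{T}}|x(t)-\hat{x}(t)|+\sup_{t\in\mathbb{T}^\kappa}|\Delta[x](t)-\Delta[\hat{x}](t)|<\delta$. *)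

(* Defs.v *)
From HB Require Import structures.
From mathcomp Require Import all_boot all_order all_algebra.
From mathcomp Require Import all_classical all_reals all_analysis.

Set Implicit Arguments.
Unset Strict Implicit.
Unset Printing Implicit Defensive.

Import Order.TTheory GRing.Theory Num.Theory.
Import numFieldNormedType.Exports.

Local Open Scope classical_set_scope.
Local Open Scope ring_scope.

(* A function on a time scale T is represented by a total function R -> R;
   every notion below depends only on its values on T. *)

Definition time_scale (R : realType) (T : set R) : Prop :=
  T !=set0 /\ closed T.

Definition is_min (R : realType) (T : set R) (a : R) : Prop :=
  T a /\ lbound T a.

Definition is_max (R : realType) (T : set R) (b : R) : Prop :=
  T b /\ ubound T b.

(* The explicit case split implements inf set0 = sup T and sup set0 = inf T:
   the real-valued inf and sup of the library are 0 on the empty set.  For t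
   in T, the first branch of sigma (resp. rho) is taken only when T is bounded
   above (resp. below). *)
Definition sigma (R : realType) (T : set R) (t : R) : R :=
  let S := [set s | T s /\ t < s] in
  if S == set0 then sup T else inf S.

Definition rho (R : realType) (T : set R) (t : R) : R :=
  let S := [set s | T s /\ s < t] in
  if S == set0 then inf T else sup S.

Definition left_scattered (R : realType) (T : set R) (t : R) : Prop :=
  rho T t < t.

(* The bounds of T are taken in the extended reals, as T may be unbounded. *)
Definition right_dense (R : realType) (T : set R) (t : R) : Prop :=
  (t%:E < ereal_sup (EFin @` T))%E /\ sigma T t = t.

Definition left_dense (R : realType) (T : set R) (t : R) : Prop :=
  (ereal_inf (EFin @` T) < t%:E)%E /\ rho T t = t.

Definition kappa (R : realType) (T : set R) : set R :=
  T `\` [set M | is_max T M /\ left_scattered T M].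

Definition is_delta_deriv (R : realType) (T : set R) (f : R -> R) (t d : R)
  : Prop :=
  forall eps : R, 0 < eps ->
    \forall s \near within T (nbhs t),
      `|f (sigma T t) - f s - d * (sigma T t - s)|
        <= eps * `|sigma T t - s|.

Definition delta_differentiable (R : realType) (T : set R) (f : R -> R)
  : Prop :=
  forall t, kappa T t -> exists d, is_delta_deriv T f t d.

(* The delta derivative is unique at the points of kappa T as soon as T has at
   least two points; the value is unspecified elsewhere, and 0 where no
   derivative exists. *)
Definition delta_deriv (R : realType) (T : set R) (f : R -> R) (t : R) : R :=
  xget 0 [set d | is_delta_deriv T f t d].

(* Here f is a function on D, a subset of T (T itself or kappa T). *)
Definition rd_continuous (R : realType) (T D : set R) (f : R -> R) : Prop :=
  (forall t, D t -> right_dense T t -> f @ within D (nbhs t) --> f t) /\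
  (forall t, D t -> left_dense T t ->
     exists l : R, f @ within (D `&` [set s | s < t]) (nbhs t) --> l).

Definition C1rd (R : realType) (T : set R) (f : R -> R) : Prop :=
  delta_differentiable T f /\ rd_continuous T (kappa T) (delta_deriv T f).

Definition is_delta_antideriv (R : realType) (T : set R) (f xi : R -> R)
  : Prop :=
  forall t, kappa T t -> is_delta_deriv T xi t (f t).

(* Antiderivatives differ by a constant on T, so that the increment
   xi d - xi c does not depend on the choice of xi; the value is 0 when there
   is no antiderivative. *)
Definition delta_int (R : realType) (T : set R) (f : R -> R) (c d : R) : R :=
  xget 0 [set I | exists xi, is_delta_antideriv T f xi /\ I = xi d - xi c].

(* Partial derivatives of L = L(t, x, v) on [a, b] * R * R.  The difference
   quotient in t is restricted to [a, b], hence is one-sided at a and b. *)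
Definition quotient1 (R : realType) (L : R -> R -> R -> R) (t x v s : R) : R :=
  (L s x v - L t x v) / (s - t).

Definition partial1 (R : realType) (a b : R) (L : R -> R -> R -> R)
    (t x v : R) : R :=
  lim (quotient1 L t x v s @[s --> within `[a, b] (dnbhs t)]).

Definition partial2 (R : realType) (L : R -> R -> R -> R) (t x v : R) : R :=
  derive1 (fun y => L t y v) x.

Definition partial3 (R : realType) (L : R -> R -> R -> R) (t x v : R) : R :=
  derive1 (fun w => L t x w) v.

Definition C1_lagrangian (R : realType) (a b : R) (L : R -> R -> R -> R)
  : Prop :=
  let D : set (R * R * R) := `[a, b] `*` setT `*` setT in
  [/\ forall t x v, a <= t <= b ->
        [/\ cvg (quotient1 L t x v s @[s --> within `[a, b] (dnbhs t)]),
            derivable (fun y => L t y v) x 1 &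
            derivable (fun w => L t x w) v 1],
      {within D, continuous (fun p => partial1 a b L p.1.1 p.1.2 p.2)},
      {within D, continuous (fun p => partial2 L p.1.1 p.1.2 p.2)} &
      {within D, continuous (fun p => partial3 L p.1.1 p.1.2 p.2)}].

Definition functional (R : realType) (T : set R) (a b : R)
    (L : R -> R -> R -> R) (x : R -> R) : R :=
  delta_int T (fun t => L t (x t) (delta_deriv T x t)) a b.

Definition C1_distance (R : realType) (T : set R) (x y : R -> R) : \bar R :=
  (ereal_sup [set `|x t - y t|%:E | t in T] +
   ereal_sup [set `|delta_deriv T x t - delta_deriv T y t|%:E
             | t in kappa T])%E.

Definition admissible (R : realType) (T : set R) (a b xa xb : R) (x : R -> R)
  : Prop :=
  [/\ C1rd T x, x a = xa & x b = xb].

Definition local_minimizer (R : realType) (T : set R) (a b xa xb : R)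
    (J : (R -> R) -> R) (xh : R -> R) : Prop :=
  admissible T a b xa xb xh /\
  exists2 delta : R, 0 < delta &
    forall x, admissible T a b xa xb x ->
      (C1_distance T x xh < delta%:E)%E -> J xh <= J x.

Definition local_maximizer (R : realType) (T : set R) (a b xa xb : R)
    (J : (R -> R) -> R) (xh : R -> R) : Prop :=
  admissible T a b xa xb xh /\
  exists2 delta : R, 0 < delta &
    forall x, admissible T a b xa xb x ->
      (C1_distance T x xh < delta%:E)%E -> J x <= J xh.

(* Main.v *)
Require Import Defs.
From HB Require Import structures.
From mathcomp Require Import all_boot all_order all_algebra.
From mathcomp Require Import all_classical all_reals all_analysis.
From mathcomp Require Import ring lra.
Import Order.TTheory GRing.Theory Num.Theory.
Import numFieldNormedType.Exports.
Local Open Scope classical_set_scope.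
Local Open Scope ring_scope.

Set Implicit Arguments.
Unset Strict Implicit.
Unset Printing Implicit Defensive.

(** The Euler-Lagrange equation in integral form is the du Bois-Reymond lemma
    applied to the first variation.  Write p and q for the second and third
    partial derivatives of L along xh, let P be a delta antiderivative of p,
    and put g = q - P o sigma, c the mean value of g over the time scale.  The
    antiderivative eta of g - c that vanishes at a vanishes at b as well, so it
    is an admissible variation.  By the product rule
    (P eta)^Delta = (P o sigma) eta^Delta + p eta, the first variation
    p eta + q eta^Delta in the direction eta differs from (g - c)^2 by the
    derivative of P eta + c eta, a function that vanishes at both ends.  At an
    extremizer the first variation has integral zero (first_variation), so
    (g - c)^2 has integral zero, and a nonnegative derivative with integral zero
    vanishes at every point (antideriv_ge0_eq0): this is the equation.

    The calculus behind this argument rests on two facts.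

    The mean value inequality (antideriv_nondecr): a function whose delta
    derivative is nonnegative is nondecreasing.  It makes delta integrals well
    defined, bounds them, and shows that the derivative of a C^1_rd function is
    continuous at a left-dense maximum (C1rd_deriv_rd_cont).

    The existence of antiderivatives (rd_cont_antideriv).  An rd-continuous
    function is bounded, by compactness; the largest function whose increment
    over each [u, v] is at most (v - u) sup f is then an upper Darboux
    integral of f (interval_integral), and its delta derivative is f at the
    right-scattered points and at the points where f is continuous.

    That the functional is differentiable along eta follows from an expansion of
    L to first order that is uniform on compact sets (lagrangian_expansion),
    integrated by the mean value inequality. *)

(** * Preliminaries on subsets of the line *)

Lemma near_within_distP (R : realType) (D : set R) (t : R) (P : R -> Prop) :
  (\forall s \near within D (nbhs t), P s) <->
  exists2 e : R, 0 < e & forall s, D s -> `|t - s| < e -> P s.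
Proof.
split => [[e e0 H]|[e e0 H]].
  by exists e => // s Ds ts; exact: H.
by exists e => // s /= ts Ds; exact: H.
Qed.

Lemma closed_has_inf (R : realType) (D E : set R) :
  closed D -> E `<=` D -> has_inf E -> D (inf E).
Proof.
move=> cD ED iE; apply: cD => B [e e0 eB].
have [x Ex xe] := inf_adherent e0 iE.
exists x; split; first exact: ED.
apply: eB => /=; have := ge_inf iE.2 Ex; rewrite ltr_distlC.
lra.
Qed.

Lemma closed_has_sup (R : realType) (D E : set R) :
  closed D -> E `<=` D -> has_sup E -> D (sup E).
Proof.
move=> cD ED sE; apply: cD => B [e e0 eB].
have [x Ex xe] := sup_adherent e0 sE.
exists x; split; first exact: ED.
apply: eB => /=; have := ub_le_sup sE.2 Ex; rewrite ltr_distlC.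
lra.
Qed.

(** * Lagrangians *)

Section Lagrangian.
Variables (R : realType) (a b : R).

Local Notation D := (`[a, b] `*` setT `*` setT : set (R * R * R)).

Lemma continuous3P (F : R -> R -> R -> R) :
  {within D, continuous (fun p : R * R * R => F p.1.1 p.1.2 p.2)} <->
  forall t x v e, a <= t <= b -> 0 < e ->
  exists2 h : R, 0 < h & forall s y w, a <= s <= b ->
    `|t - s| < h -> `|x - y| < h -> `|v - w| < h -> `|F t x v - F s y w| <= e.
Proof.
split => [/subspace_continuousP cF t x v e tab e0|H].
  have Dp : D (t, x, v) by split => //; split => //=; rewrite in_itv.
  have /cvgrPdist_le/(_ e e0) := cF _ Dp.
  move=> /nbhs_ballP[h h0 Hh]; exists h => // s y w sab ts xy vw.
  apply: (Hh (s, y, w)); first by split => //; split.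
  by split => //; split => //=; rewrite in_itv.
apply/subspace_continuousP => -[[t x] v] [[/= tab _] _].
rewrite in_itv /= in tab.
apply/cvgrPdist_le => e e0; have [h h0 Hh] := H t x v e tab e0.
apply/nbhs_ballP; exists h => // -[[s y] w] [[/= ts xy] vw] [[/= sab _] _].
by rewrite in_itv /= in sab; exact: Hh.
Qed.

(** Compactness of the box [a, b] * [- M, M] * [- M, M] makes the modulus of
    continuity uniform; (y, w) itself may lie outside the box. *)
Lemma continuous3_uniform (F : R -> R -> R -> R) (M e : R) : 0 < e ->
  {within D, continuous (fun p : R * R * R => F p.1.1 p.1.2 p.2)} ->
  exists2 h : R, 0 < h & forall t x v y w, a <= t <= b ->
    `|x| <= M -> `|v| <= M -> `|x - y| < h -> `|v - w| < h ->
    `|F t x v - F t y w| <= e.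
Proof.
move=> e0 /continuous3P cF.
pose B : set (R * R * R) := `[a, b] `*` `[- M, M] `*` `[- M, M].
have cB : compact B.
  by apply: compact_setX; [apply: compact_setX|]; exact: segment_compact.
have /compact_near_coveringP/near_covering_withinP cov := cB.
pose P (h : R) (p : R * R * R) := forall y w,
  `|p.1.2 - y| < h -> `|p.2 - w| < h -> `|F p.1.1 p.1.2 p.2 - F p.1.1 y w| <= e.
have : \forall h \near 0^'+, B `<=` P h.
  apply: cov => -[[t x] v] [[/= tab _] _]; rewrite in_itv /= in tab.
  have e20 : 0 < e / 2 by lra.
  have [h h0 H] := cF t x v (e / 2) tab e20.
  have h20 : 0 < h / 2 by lra.
  exists (ball (t, x, v) (h / 2), [set k | k < h / 2]) => /=.
    by split; [exact: nbhsx_ballx|exact: nbhs_right_lt].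
  move=> [[[s y] w] k] /= [[[/= ts xy] vw] kh] [[/= sab _] _] y' w' /= yy' ww'.
  rewrite in_itv /= in sab.
  have := H s y w sab; have := H s y' w' sab.
  rewrite /ball /= in ts xy vw.
  have -> : `|t - s| < h by lra.
  have -> : `|x - y| < h by lra.
  have -> : `|v - w| < h by lra.
  have -> : `|x - y'| < h.
    have -> : x - y' = (x - y) + (y - y') by ring.
    by apply: (le_lt_trans (ler_normD _ _)); lra.
  have -> : `|v - w'| < h.
    have -> : v - w' = (v - w) + (w - w') by ring.
    by apply: (le_lt_trans (ler_normD _ _)); lra.
  move=> /(_ isT isT isT) h1 /(_ isT isT isT) h2.
  have -> : F s y w - F s y' w' =
      (F t x v - F s y' w') - (F t x v - F s y w) by ring.
  by apply: (le_trans (ler_normB _ _)); lra.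
move=> [h /= h0 H]; exists (h / 2); first lra.
move=> t x v y w tab xM vM; apply: (H (h / 2) _ _ (t, x, v)) => /=.
- by rewrite sub0r normrN gtr0_norm; lra.
- lra.
- by split => //=; [split => //=|]; rewrite ?in_itv // /= -ler_norml.
Qed.

(** The mean value theorem, as an estimate valid for either sign of u. *)
Lemma mean_value_dist (g : R -> R) (x u k e : R) :
  (forall z, derivable g z 1) ->
  (forall z, `|x - z| <= `|u| -> `|derive1 g z - k| <= e) ->
  `|g (x + u) - g x - k * u| <= e * `|u|.
Proof.
move=> dg He.
have mvt y z : y <= z ->
    exists2 c, y <= c <= z & g z - g y = derive1 g c * (z - y).
  move=> yz; have [||c cyz E] := @MVT_segment R g (derive1 g) y z yz.
  - by move=> c _; rewrite derive1E; apply/derivableP.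
  - by apply: derivable_within_continuous => c _.
  - by exists c => //; rewrite in_itv in cyz.
have [c xc E] : exists2 c, `|x - c| <= `|u| & g (x + u) - g x = derive1 g c * u.
  have [u0|u0] := leP 0 u.
    have [|c /andP[c1 c2] E] := mvt x (x + u); first lra.
    exists c; last by rewrite E; congr (_ * _); ring.
    by rewrite (ger0_norm u0) ler0_norm; lra.
  have [|c /andP[c1 c2] E] := mvt (x + u) x; first lra.
  exists c; last by rewrite -opprB E; ring.
  by rewrite (ltr0_norm u0) ger0_norm; lra.
by rewrite E -mulrBl normrM; apply: ler_wpM2r => //; exact: He.
Qed.

Variable L : R -> R -> R -> R.
Hypothesis hL : C1_lagrangian a b L.

(** First-order expansion of L in (x, v), uniform on compact sets: move x first,
    then v, and compare the partial derivatives at the intermediate points with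
    those at (t, x, v) by uniform continuity. *)
Lemma lagrangian_expansion (M e : R) : 0 < e ->
  exists2 h : R, 0 < h & forall t x v u w, a <= t <= b ->
    `|x| <= M -> `|v| <= M -> `|u| < h -> `|w| < h ->
    `|L t (x + u) (v + w) - L t x v
       - (partial2 L t x v * u + partial3 L t x v * w)| <= e * (`|u| + `|w|).
Proof.
move=> e0; have [dL _ c2 c3] := hL.
have [h2 h20 H2] := continuous3_uniform M e0 c2.
have [h3 h30 H3] := continuous3_uniform M e0 c3.
exists (Num.min h2 h3); first by rewrite lt_min h20.
move=> t x v u w tab xM vM; rewrite !lt_min => /andP[u2 u3] /andP[w2 w3].
have A : `|L t (x + u) (v + w) - L t x (v + w) - partial2 L t x v * u|
    <= e * `|u|.
  have := @mean_value_dist (fun y => L t y (v + w)) x u (partial2 L t x v) e.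
  apply => z; first by have [_ d _] := dL t z (v + w) tab; exact: d.
  move=> xz; rewrite -/(partial2 L t z (v + w)) distrC; apply: H2 => //.
    exact: le_lt_trans xz u2.
  by rewrite opprD addrA subrr sub0r normrN.
have B : `|L t x (v + w) - L t x v - partial3 L t x v * w| <= e * `|w|.
  have := @mean_value_dist (fun y => L t x y) v w (partial3 L t x v) e.
  apply => z; first by have [_ _ d] := dL t x z tab; exact: d.
  move=> vz; rewrite -/(partial3 L t x z) distrC; apply: H3 => //.
    by rewrite subrr normr0.
  exact: le_lt_trans vz w3.
rewrite mulrDr; apply: le_trans (lerD A B); apply: le_trans (ler_normD _ _).
by rewrite le_eqVlt; apply/orP; left; apply/eqP; congr `|_|; ring.
Qed.

(** A convergent difference quotient is bounded near t, which bounds the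
    increments of L in time by a multiple of `|t - s|. *)
Lemma lagrangian_continuous_time t x v e : a <= t <= b -> 0 < e ->
  exists2 h : R, 0 < h & forall s, a <= s <= b -> `|t - s| < h ->
    `|L t x v - L s x v| <= e.
Proof.
move=> tab e0; have [/(_ t x v tab)[/cvg_ex[/= l ql] _ _] _ _ _] := hL.
have /cvgrPdist_le/(_ 1 ltr01) [h /= h0 H] := ql.
have l0 := normr_ge0 l.
pose k := e / (`|l| + 1).
have k0 : 0 < k by apply: divr_gt0; lra.
have kE : (`|l| + 1) * k = e by rewrite /k mulrC divfK //; apply/eqP; lra.
exists (Num.min h k); first by rewrite lt_min h0.
move=> s sab; rewrite lt_min => /andP[sh sk].
have [->|st] := eqVneq s t; first by rewrite subrr normr0 ltW.
have := H s sh st; rewrite /= in_itv => /(_ sab); rewrite /quotient1 => Hs.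
have st0 : s - t != 0 by rewrite subr_eq0.
have -> : L t x v - L s x v =
    (l - (L s x v - L t x v) / (s - t)) * (s - t) - l * (s - t).
  by field.
apply: (le_trans (ler_normB _ _)); rewrite !normrM (distrC s t).
have : `|l - (L s x v - L t x v) / (s - t)| * `|t - s| <= 1 * `|t - s|.
  exact: ler_wpM2r.
have : (`|l| + 1) * `|t - s| <= (`|l| + 1) * k by apply: ler_wpM2l; lra.
lra.
Qed.

Lemma continuous3_locally_bounded (F : R -> R -> R -> R) t x v :
  {within D, continuous (fun p : R * R * R => F p.1.1 p.1.2 p.2)} ->
  a <= t <= b ->
  exists C h : R, [/\ 0 < C, 0 < h & forall s, a <= s <= b -> `|t - s| < h ->
    `|F s x v| <= C].
Proof.
move=> /continuous3P cF tab; have [h h0 H] := cF t x v 1 tab ltr01.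
exists (`|F t x v| + 1), h; split => // s sab ts.
rewrite -[F s x v](subKr (F t x v)); apply: (le_trans (ler_normB _ _)).
by rewrite lerD2l; apply: H => //; rewrite subrr normr0.
Qed.

(** Separate continuity in t suffices for joint continuity, because the partial
    derivatives in x and v are bounded near (t, x, v), so that L is Lipschitz in
    (x, v) there, uniformly in the time. *)
Lemma lagrangian_continuous :
  {within D, continuous (fun p : R * R * R => L p.1.1 p.1.2 p.2)}.
Proof.
apply/continuous3P => t x v e tab e0; have [_ _ c2 c3] := hL.
have e20 : 0 < e / 2 by lra.
have [h1 h10 H1] := lagrangian_continuous_time x v tab e20.
have [C2 [h2 [C20 h20 H2]]] := continuous3_locally_bounded x v c2 tab.
have [C3 [h3 [C30 h30 H3]]] := continuous3_locally_bounded x v c3 tab.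
have [h4 h40 H4] := lagrangian_expansion (`|x| + `|v|) ltr01.
pose C := C2 + C3 + 2.
pose k := e / (2 * C).
have k0 : 0 < k by apply: divr_gt0; rewrite /C; lra.
have kE : C * k = e / 2 by rewrite /k /C; field; apply/eqP; lra.
exists (Num.min k (Num.min h1 (Num.min h2 (Num.min h3 h4)))).
  by rewrite !lt_min k0 h10 h20 h30 h40.
move=> s y w sab; rewrite !lt_min.
move=> /and5P[_ s1 s2 s3 _] /and5P[yk _ _ _ y4] /and5P[wk _ _ _ w4].
have {H2}E2 := H2 s sab s2; have {H3}E3 := H3 s sab s3.
have {H1}E1 := H1 s sab s1.
have := H4 s x v (y - x) (w - v) sab.
rewrite lerDl normr_ge0 lerDr normr_ge0 (distrC y) (distrC w).
move=> /(_ isT isT y4 w4) {H4}; rewrite (addrC x) (addrC v) !subrK.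
move: (partial2 L s x v) (partial3 L s x v) E2 E3 => p2 p3 E2 E3.
set d := (X in `|X|) => E4.
have -> : L t x v - L s y w =
    (L t x v - L s x v) - (d + (p2 * (y - x) + p3 * (w - v))).
  by rewrite /d; ring.
have F2 : `|p2 * (y - x)| <= C2 * k.
  by rewrite normrM distrC ler_pM // ltW.
have F3 : `|p3 * (w - v)| <= C3 * k.
  by rewrite normrM distrC ler_pM // ltW.
apply: (le_trans (ler_normB _ _)).
have := ler_normD d (p2 * (y - x) + p3 * (w - v)).
have := ler_normD (p2 * (y - x)) (p3 * (w - v)).
move: E1 E4 F2 F3 kE yk wk; rewrite /C; clearbody d; lra.
Qed.

End Lagrangian.

Section BoundedTimeScale.
Variables (R : realType) (T : set R) (a b : R).
Hypotheses (cT : closed T) (ha : is_min T a) (hb : is_max T b) (ab : a < b).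

Local Notation K := (kappa T).

(** * Jumps and dense points *)

Lemma T_ge t : T t -> a <= t. Proof. by case: ha => _; apply. Qed.

Lemma T_le t : T t -> t <= b. Proof. by case: hb => _; apply. Qed.

Lemma sigma_max : sigma T b = b.
Proof.
rewrite /sigma; case: eqP => [_|/eqP/set0P[s [/T_le sb bs]]]; last by lra.
apply/le_anti/andP; split.
  by apply: ge_sup; [exists b; case: hb | exact: T_le].
by apply: ub_le_sup; [exists b; exact: T_le | case: hb].
Qed.

Lemma sigmaE t : t < b -> sigma T t = inf [set s | T s /\ t < s].
Proof.
move=> tb; rewrite /sigma; case: eqP => // E.
have : [set s | T s /\ t < s] b by split => //; case: hb.
by rewrite E.
Qed.

Lemma rhoE t : a < t -> rho T t = sup [set s | T s /\ s < t].
Proof.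
move=> tb; rewrite /rho; case: eqP => // E.
have : [set s | T s /\ s < t] a by split => //; case: ha.
by rewrite E.
Qed.

Lemma has_inf_right t : t < b -> has_inf [set s | T s /\ t < s].
Proof.
move=> tb; split; first by exists b; split => //; case: hb.
by exists t => s [_ /ltW].
Qed.

Lemma has_sup_left t : a < t -> has_sup [set s | T s /\ s < t].
Proof.
move=> tb; split; first by exists a; split => //; case: ha.
by exists t => s [_ /ltW].
Qed.

Lemma sigma_in t : T t -> T (sigma T t).
Proof.
move=> Tt; have := T_le Tt; rewrite le_eqVlt => /predU1P[->|tb].
  by rewrite sigma_max; case: hb.
by rewrite sigmaE //; apply: closed_has_inf (has_inf_right tb) => // s [].
Qed.

Lemma sigma_ge t : T t -> t <= sigma T t.
Proof.
move=> Tt; have := T_le Tt; rewrite le_eqVlt => /predU1P[->|tb].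
  by rewrite sigma_max.
by rewrite sigmaE //; apply: lb_le_inf (has_inf_right tb).1 _ => s [_ /ltW].
Qed.

Lemma sigma_le t s : T s -> t < s -> sigma T t <= s.
Proof.
move=> Ts ts; have tb : t < b by exact: lt_le_trans ts (T_le Ts).
by rewrite sigmaE //; apply: ge_inf => //; exact: (has_inf_right tb).2.
Qed.

Lemma rho_in t : a < t -> T (rho T t).
Proof.
move=> t_a; rewrite rhoE //.
by apply: closed_has_sup (has_sup_left t_a) => // s [].
Qed.

Lemma rho_le t : a < t -> rho T t <= t.
Proof.
move=> t_a; rewrite rhoE //.
by apply: ge_sup (has_sup_left t_a).1 _ => s [_ /ltW].
Qed.

Lemma rho_ge t s : T s -> s < t -> s <= rho T t.
Proof.
move=> Ts st; have ta : a < t by exact: le_lt_trans (T_ge Ts) st.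
by rewrite rhoE //; apply: ub_le_sup => //; exact: (has_sup_left ta).2.
Qed.

Lemma right_approx t (e : R) : t < b -> sigma T t = t -> 0 < e ->
  exists s, [/\ T s, t < s & s < t + e].
Proof.
move=> tb st e0; have [s [Ts ts] se] := inf_adherent e0 (has_inf_right tb).
by exists s; split => //; rewrite -sigmaE // st in se.
Qed.

Lemma left_approx t (e : R) : a < t -> rho T t = t -> 0 < e ->
  exists s, [/\ T s, s < t & t - e < s].
Proof.
move=> tb st e0; have [s [Ts ts] se] := sup_adherent e0 (has_sup_left tb).
by exists s; split => //; rewrite -rhoE // st in se.
Qed.

(** Otherwise sigma (rho t) would be a point of T below t, hence equal to rho t,
    and rho t would be right-dense, so that there would be points of T strictly
    between rho t and t. *)
Lemma sigma_rho t : T t -> a < t -> rho T t < t -> sigma T (rho T t) = t.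
Proof.
move=> Tt ta rt; apply/le_anti; rewrite sigma_le //= leNgt; apply/negP => st.
have Tr := rho_in ta; have := rho_ge (sigma_in Tr) st.
have := sigma_ge Tr => h1 h2.
have sr : sigma T (rho T t) = rho T t by lra.
have rb : rho T t < b by apply: lt_le_trans rt (T_le Tt).
have e0 : 0 < t - rho T t by lra.
have [s [Ts rs st']] := right_approx rb sr e0.
have : s <= rho T t by apply: rho_ge => //; lra.
lra.
Qed.

Lemma kappa_sub t : K t -> T t. Proof. by case. Qed.

Lemma kappa_lt t : T t -> t < b -> K t.
Proof.
move=> Tt tb; split => // -[[_ /(_ b)]] Htb _.
have := Htb hb.1; lra.
Qed.

Lemma kappa_max : K b -> rho T b = b.
Proof.
move=> [_ /not_andP[]// H]; apply/le_anti; rewrite rho_le //= leNgt.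
exact/negP.
Qed.

Lemma kappaNmax : ~ K b -> rho T b < b.
Proof.
by move=> nK; apply: contrapT => h; apply: nK; split; [case: hb|case].
Qed.

Lemma lt_max_or_eq t : T t -> t < b \/ t = b.
Proof. by move=> /T_le; rewrite le_eqVlt => /predU1P[->|?]; [right|left]. Qed.

Lemma left_denseP t : left_dense T t <-> a < t /\ rho T t = t.
Proof.
suff E : ereal_inf (EFin @` T) = a%:E by rewrite /left_dense E lte_fin.
apply/le_anti/andP; split.
  by apply: ereal_inf_lbound; exists a => //; case: ha.
by apply/ereal_infP => _ [s Ts <-]; rewrite lee_fin T_ge.
Qed.

Lemma right_dense_sigma t : T t -> sigma T t = t -> t < b -> right_dense T t.
Proof.
move=> Tt st tb; split => //; apply: (@lt_le_trans _ _ b%:E).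
  by rewrite lte_fin.
by apply: ereal_sup_ubound; exists b => //; case: hb.
Qed.

Lemma compactT : compact T.
Proof.
apply: (subclosed_compact cT (@segment_compact _ a b)) => t Tt /=.
by rewrite in_itv /= T_ge ?T_le.
Qed.

(** Every neighbourhood of a point t of the domain of the delta derivative
    contains a point s of T other than sigma t.  This fails only at a
    left-scattered maximum, and it is what makes delta derivatives unique. *)
Lemma kappa_approx t (e : R) : K t -> 0 < e ->
  exists s, [/\ T s, `|t - s| < e & s != sigma T t].
Proof.
move=> Kt e0; have Tt := kappa_sub Kt.
have [st|st] := eqVneq (sigma T t) t; last first.
  by exists t; rewrite subrr normr0 eq_sym.
case: (lt_max_or_eq Tt) => [tb|tb].
  have [s [Ts ts se]] := right_approx tb st e0.
  by exists s; rewrite st gt_eqF // ltr_distlC; split => //; lra.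
rewrite {}tb in st Kt Tt *.
have [s [Ts ts se]] := left_approx ab (kappa_max Kt) e0.
by exists s; rewrite st lt_eqF // ltr_distlC; split => //; lra.
Qed.

(** * Delta derivatives *)

(** The definition compares f s with f (sigma t), not with f t; continuity at t
    comes from subtracting the inequality at s = t. *)
Lemma delta_deriv_cont f t d : T t -> is_delta_deriv T f t d ->
  f @ within T (nbhs t) --> f t.
Proof.
move=> Tt fd; apply/cvgrPdist_le => e e0.
have m0 := sigma_ge Tt; set m := sigma T t - t.
(* For `|t - s| <= 1 the inequalities at s and at t give an error of at most
   eta * (m + 1) + eta * m, which is e / 2. *)
pose eta := e / (2 * (2 * m + 1)).
have eta0 : 0 < eta by apply: divr_gt0 => //; rewrite /m; lra.
have etaE : eta * (2 * m + 1) = e / 2.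
  by rewrite /eta; field; rewrite /m; apply/eqP; lra.
have [h h0 H] := (near_within_distP _ _ _).1 (fd _ eta0).
have Ht := H t Tt; rewrite subrr normr0 in Ht.
have {}Ht := Ht h0.
pose D := e / (2 * (`|d| + 1)).
have D0 : 0 < D by rewrite divr_gt0 //; have := normr_ge0 d; lra.
have dD : `|d| * D <= e / 2.
  suff : D * (`|d| + 1) = e / 2 by lra.
  by rewrite /D; field; apply/eqP; have := normr_ge0 d; lra.
apply/near_within_distP; exists (Num.min h (Num.min 1 D)).
  by rewrite !lt_min h0 ltr01.
move=> s Ts; rewrite !lt_min => /and3P[sh s1 sD].
have {}H := H s Ts sh.
have E : f t - f s = (f (sigma T t) - f s - d * (sigma T t - s))
   - (f (sigma T t) - f t - d * (sigma T t - t)) + d * (t - s) by ring.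
rewrite E; apply: (le_trans (ler_normD _ _)).
rewrite normrM; have := ler_normB (f (sigma T t) - f s - d * (sigma T t - s))
   (f (sigma T t) - f t - d * (sigma T t - t)).
have h1 : `|d| * `|t - s| <= `|d| * D by apply: ler_wpM2l => //; lra.
have h2 : `|sigma T t - t| = m by rewrite ger0_norm // /m; lra.
have h3 : `|sigma T t - s| <= m + 1.
  rewrite -h2; have -> : sigma T t - s = (sigma T t - t) + (t - s) by ring.
  by apply: (le_trans (ler_normD _ _)); lra.
rewrite h2 in Ht.
have : eta * `|sigma T t - s| <= eta * (m + 1) by apply: ler_wpM2l => //; lra.
move: etaE Ht H; rewrite /=; lra.
Qed.

Lemma delta_deriv_uniq f t d d' : K t ->
  is_delta_deriv T f t d -> is_delta_deriv T f t d' -> d = d'.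
Proof.
move=> Kt fd fd'; apply/eqP; rewrite -subr_eq0 -normr_le0.
apply/ler_addgt0Pl => e e0; rewrite addr0.
have e20 : 0 < e / 2 by lra.
have [h h0 H] := (near_within_distP _ _ _).1 (fd _ e20).
have [k k0 H'] := (near_within_distP _ _ _).1 (fd' _ e20).
have hk : 0 < Num.min h k by rewrite lt_min h0.
have [s [Ts]] := kappa_approx Kt hk; rewrite lt_min => /andP[sh sk] ss.
have {}ss : 0 < `|sigma T t - s| by rewrite normr_gt0 subr_eq0 eq_sym.
rewrite -(ler_pM2r ss) -normrM.
have := ler_normB (f (sigma T t) - f s - d' * (sigma T t - s))
  (f (sigma T t) - f s - d * (sigma T t - s)).
have := H s Ts sh; have := H' s Ts sk.
set A := `|_ - _ - d' * _|; set B := `|_ - _ - d * _|.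
rewrite [X in `|X| <= A + B](_ : _ = (d - d') * (sigma T t - s)); last by ring.
lra.
Qed.

Lemma delta_derivE f t d : K t -> is_delta_deriv T f t d ->
  delta_deriv T f t = d.
Proof.
move=> Kt fd; apply: (delta_deriv_uniq Kt _ fd).
by apply: (@xgetPex _ 0 [set d | is_delta_deriv T f t d]); exists d.
Qed.

Lemma is_delta_deriv_lin f g t (k d e : R) :
  is_delta_deriv T f t d -> is_delta_deriv T g t e ->
  is_delta_deriv T (fun s => f s + k * g s) t (d + k * e).
Proof.
move=> fd ge eps eps0.
have e1 : 0 < eps / (1 + `|k|).
  by apply: divr_gt0 => //; have := normr_ge0 k; lra.
have eE : eps = eps / (1 + `|k|) * (1 + `|k|).
  by rewrite divfK //; have := normr_ge0 k => ?; apply/eqP; lra.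
move: (fd _ e1) (ge _ e1); apply: filterS2 => s Hf Hg.
rewrite [X in `|X|](_ : _ = (f (sigma T t) - f s - d * (sigma T t - s)) +
  k * (g (sigma T t) - g s - e * (sigma T t - s))); last by ring.
apply: (le_trans (ler_normD _ _)); rewrite normrM [in leRHS]eE.
set E := eps / _ in Hf Hg *.
have : `|k| * `|g (sigma T t) - g s - e * (sigma T t - s)| <=
  `|k| * (E * `|sigma T t - s|) by apply: ler_wpM2l.
lra.
Qed.

Lemma is_delta_deriv_mul f g t (d e : R) : T t ->
  is_delta_deriv T f t d -> is_delta_deriv T g t e ->
  is_delta_deriv T (fun s => f s * g s) t (f (sigma T t) * e + d * g t).
Proof.
move=> Tt fd ge eps eps0.
have /cvgrPdist_le gc := delta_deriv_cont Tt ge.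
pose A := `|f (sigma T t)| + `|g t| + `|d| + 1.
have A0 : 0 < A by rewrite ltr_wpDl // !addr_ge0.
have gt0 := normr_ge0 (g t); have d0 := normr_ge0 d.
have f0 := normr_ge0 (f (sigma T t)).
pose eta := Num.min 1 (eps / (2 * A)).
have eta0 : 0 < eta by rewrite lt_min ltr01 divr_gt0 //; lra.
have eta1 : eta <= 1 by rewrite ge_min lexx.
have etaA : eta * (2 * A) <= eps.
  rewrite -ler_pdivlMr; last by lra.
  by rewrite ge_min lexx orbT.
move: (fd _ eta0) (ge _ eta0) (gc _ eta0); apply: filterS3 => s Hf Hg Hc.
rewrite [X in `|X|](_ : _ =
   f (sigma T t) * (g (sigma T t) - g s - e * (sigma T t - s)) +
   (g s * (f (sigma T t) - f s - d * (sigma T t - s)) -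
    d * (sigma T t - s) * (g t - g s))); last by ring.
apply: (le_trans (ler_normD _ _)).
apply: (le_trans (lerD (lexx _) (ler_normB _ _))); rewrite !normrM.
have gs : `|g s| <= `|g t| + 1.
  have -> : g s = g t - (g t - g s) by ring.
  by apply: (le_trans (ler_normB _ _)); lra.
set S := `|sigma T t - s| in Hf Hg *.
have S0 : 0 <= S by exact: normr_ge0.
have gs0 := normr_ge0 (g s).
have h1 : `|f (sigma T t)| * `|g (sigma T t) - g s - e * (sigma T t - s)| <=
   `|f (sigma T t)| * (eta * S) by apply: ler_wpM2l.
have h2 : `|g s| * `|f (sigma T t) - f s - d * (sigma T t - s)| <=
   (`|g t| + 1) * (eta * S) by apply: ler_pM.
have h3 : `|d| * S * `|g t - g s| <= `|d| * S * eta.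
  by apply: ler_wpM2l => //; exact: mulr_ge0.
have h4 : eta * (2 * A) * S <= eps * S by apply: ler_wpM2r.
have h5 : 0 <= eta * S by apply: mulr_ge0 => //; lra.
have h6 : 0 <= A * (eta * S) by apply: mulr_ge0 => //; lra.
apply: le_trans h4; apply: (@le_trans _ _ (A * (eta * S))); last by lra.
rewrite /A; lra.
Qed.

Lemma isolated_max_cont (f : R -> R) :
  ~ K b -> f @ within T (nbhs b) --> f b.
Proof.
move=> /kappaNmax rb; apply/cvgrPdist_le => e e0.
apply/near_within_distP; exists (b - rho T b); first by lra.
move=> s Ts; rewrite ltr_distlC => /andP[sb _].
case: (lt_max_or_eq Ts) => [lt_sb|->]; last by rewrite subrr normr0 ltW.
have := rho_ge Ts lt_sb; lra.
Qed.

Lemma antideriv_cont f F t : is_delta_antideriv T f F -> T t ->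
  F @ within T (nbhs t) --> F t.
Proof.
move=> FF Tt; have [Kt|nK] := pselect (K t).
  exact: delta_deriv_cont (FF _ Kt).
case: (lt_max_or_eq Tt) => [tb|tb]; first by case: nK; exact: kappa_lt.
by rewrite tb in nK *; exact: isolated_max_cont.
Qed.

Lemma antideriv_lin f g F G k : is_delta_antideriv T f F ->
  is_delta_antideriv T g G ->
  is_delta_antideriv T (fun t => f t + k * g t) (fun t => F t + k * G t).
Proof.
by move=> FF GG t Kt; apply: is_delta_deriv_lin; [exact: FF|exact: GG].
Qed.

Lemma antideriv_cst (k : R) : is_delta_antideriv T (fun=> k) (fun t => k * t).
Proof.
move=> t Kt e e0; near=> s.
by rewrite mulrBr subrr normr0 mulr_ge0 // ltW.
Unshelve. all: by end_near. Qed.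

(** Let m be the infimum of the points t of [c, d] with F t < F c.  If m is one
    of them, it is reached from the left, where F >= F c: by continuity when m is
    left-dense, by a positive jump from rho m when m is left-scattered.  If m is
    not, it is a limit from the right of such points, while F increases to the
    right of m since its derivative there is positive. *)
Lemma antideriv_pos_nondecr f F c d : is_delta_antideriv T f F ->
  T c -> T d -> c <= d -> (forall t, T t -> c <= t < d -> 0 < f t) ->
  F c <= F d.
Proof.
move=> FF Tc Td cd f0; rewrite leNgt; apply/negP => Fdc.
pose S := [set t | [/\ T t, c <= t, t <= d & F t < F c]].
have iS : has_inf S by split; [exists d|exists c => t []].
pose m := inf S.
have Tm : T m by apply: closed_has_inf iS => // t [].
have cm : c <= m by apply: lb_le_inf iS.1 _ => t [].
have md : m <= d by apply: ge_inf iS.2 _ _; split.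
have belowm s : T s -> c <= s -> s < m -> F c <= F s.
  move=> Ts cs sm; rewrite leNgt; apply/negP => Fs.
  have : m <= s by apply: ge_inf iS.2 _ _; split => //; lra.
  lra.
have /cvgrPdist_le Fm := antideriv_cont FF Tm.
have [Sm|nSm] := pselect (S m).
  case: Sm => _ _ _ Fmc.
  have cm' : c < m.
    rewrite lt_neqAle cm andbT; apply/eqP => E; move: Fmc; rewrite -E; lra.
  have am : a < m by apply: le_lt_trans cm'; exact: T_ge.
  have := rho_le am; rewrite le_eqVlt => /predU1P[rm|rm].
    have h0 : 0 < (F c - F m) / 2 by lra.
    have [h hh H] := (near_within_distP _ _ _).1 (Fm _ h0).
    have k0 : 0 < Num.min h (m - c) by rewrite lt_min hh; lra.
    have [s [Ts sm]] := left_approx am rm k0.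
    rewrite ltrBlDr -ltrBlDl lt_min => /andP[sh sc].
    have Fs := belowm s Ts; have {}H := H s Ts.
    have : `|F m - F s| <= (F c - F m) / 2 by apply: H; rewrite gtr0_norm; lra.
    have : F c <= F s by apply: Fs => //; lra.
    rewrite ler_distlC; lra.
  have Tr := rho_in am; have cr : c <= rho T m by exact: rho_ge.
  have Kr : K (rho T m).
    by apply: kappa_lt => //; exact: lt_le_trans rm (T_le Tm).
  have fr : 0 < f (rho T m) by apply: f0 => //; apply/andP; split => //; lra.
  have [h hh H] := (near_within_distP _ _ _).1 (FF _ Kr _ fr).
  have := H _ Tr; rewrite subrr normr0 sigma_rho // => /(_ hh).
  have := belowm _ Tr cr rm.
  rewrite ler_norml (gtr0_norm (_ : 0 < m - rho T m)); last by lra.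
  move=> h1 /andP[h2 _]; lra.
have Fmc : F c <= F m.
  by rewrite leNgt; apply/negP => Fmc; apply: nSm.
have md' : m < d.
  rewrite lt_neqAle md andbT; apply/eqP => E; move: Fmc; rewrite E; lra.
have mb : m < b by apply: lt_le_trans md' (T_le Td).
have Km := kappa_lt Tm mb.
have fm : 0 < f m by apply: f0 => //; rewrite cm.
have [h hh H] := (near_within_distP _ _ _).1 (FF _ Km _ fm).
have [s Ss sm] := inf_adherent hh iS; case: (Ss) => Ts cs sd Fs.
have ms : m <= s by exact: ge_inf iS.2 _ Ss.
have {}ms : m < s.
  rewrite lt_neqAle ms andbT; apply/eqP => E; apply: nSm; by rewrite E.
have sigm : sigma T m = m.
  apply/le_anti; rewrite sigma_ge // andbT; apply/ler_addgt0Pr => e e0.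
  have [u Su um] := inf_adherent e0 iS; case: (Su) => Tu _ _ _.
  have mu : m <= u by exact: ge_inf iS.2 _ Su.
  have {}mu : m < u.
    rewrite lt_neqAle mu andbT; apply/eqP => E; apply: nSm; by rewrite E.
  by have := sigma_le Tu mu; rewrite -/m in um; lra.
have := H s Ts; rewrite sigm ltr0_norm; last by lra.
rewrite -/m in sm.
have -> : - (m - s) < h by lra.
move=> /(_ isT); rewrite ler_norml => /andP[h1 h2]; lra.
Qed.

(** The mean value inequality.  A strictly increasing linear perturbation
    reduces it to a derivative that is strictly positive. *)
Lemma antideriv_nondecr f F c d : is_delta_antideriv T f F ->
  T c -> T d -> c <= d -> (forall t, T t -> c <= t < d -> 0 <= f t) ->
  F c <= F d.
Proof.
move=> FF Tc Td cd f0; apply/ler_addgt0Pr => e e0.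
pose k := e / (d - c + 1).
have k0 : 0 < k by apply: divr_gt0 => //; lra.
have kE : k * (d - c) <= e.
  by rewrite /k mulrAC ler_pdivrMr; [apply: ler_wpM2l; lra|lra].
have := antideriv_lin 1 FF (antideriv_cst k).
move=> /antideriv_pos_nondecr/(_ Tc Td cd) H.
have : F c + 1 * (k * c) <= F d + 1 * (k * d).
  by apply: H => t Tt ctd; have := f0 t Tt ctd; lra.
lra.
Qed.

Lemma antideriv_le f g F G c d : is_delta_antideriv T f F ->
  is_delta_antideriv T g G ->
  T c -> T d -> c <= d -> (forall t, T t -> c <= t < d -> f t <= g t) ->
  F d - F c <= G d - G c.
Proof.
move=> FF GG Tc Td cd fg.
have := antideriv_lin (-1) GG FF => /antideriv_nondecr/(_ Tc Td cd) H.
have : G c + -1 * F c <= G d + -1 * F d.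
  by apply: H => t Tt ctd; have := fg t Tt ctd; lra.
lra.
Qed.

Lemma antideriv_eq f g F G c d : is_delta_antideriv T f F ->
  is_delta_antideriv T g G -> {in K, f =1 g} ->
  T c -> T d -> F d - F c = G d - G c.
Proof.
move=> FF GG fg; wlog cd : c d / c <= d => [H Tc Td|Tc Td].
  case: (leP c d) => [|/ltW] cd; first exact: H.
  by have := H d c cd Td Tc; lra.
have fg' t : T t -> c <= t < d -> f t = g t.
  move=> Tt /andP[_ td]; apply: fg; rewrite inE; apply: kappa_lt => //.
  exact: lt_le_trans td (T_le Td).
by apply/le_anti/andP; split;
  [apply: (antideriv_le FF GG)|apply: (antideriv_le GG FF)]
  => // t Tt ctd; rewrite fg'.
Qed.

Lemma delta_intE f F c d : is_delta_antideriv T f F -> T c -> T d ->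
  delta_int T f c d = F d - F c.
Proof.
move=> FF Tc Td; rewrite /delta_int; case: xgetP => [I _ [xi [xiF ->]]|].
  exact: antideriv_eq xiF FF _ Tc Td.
by move=> /(_ (F d - F c))[]; exists F.
Qed.

(** * Antiderivatives of rd-continuous functions *)

(** Differs from rd-continuity by requiring continuity at every point fixed by
    sigma, hence also at a left-dense maximum, which does not count as
    right-dense.  At such a maximum a delta derivative is the left limit of
    its values, so an integrand that jumps there has no antiderivative. *)
Definition rd_cont (f : R -> R) : Prop :=
  (forall t, K t -> sigma T t = t -> f @ within K (nbhs t) --> f t) /\
  (forall t, K t -> left_dense T t ->
     exists l : R, f @ within (K `&` [set s | s < t]) (nbhs t) --> l).

Lemma right_scattered_near t : T t -> t < sigma T t ->
  exists2 e : R, 0 < e & forall s, T s -> `|t - s| < e -> s <= t.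
Proof.
move=> Tt ts; exists (sigma T t - t); first by lra.
move=> s Ts; rewrite ltr_distlC leNgt => /andP[_ h]; apply/negP => ts'.
have := sigma_le Ts ts'; lra.
Qed.

(** On the right, f is continuous at t or there are no points of T close to t;
    on the left, f has a limit or again there are no points of T. *)
Lemma rd_cont_local_bound f t : rd_cont f -> T t ->
  exists M e : R, 0 < e /\ forall s, K s -> `|t - s| < e -> `|f s| <= M.
Proof.
move=> [fr fl] Tt.
have dist1 (l : R) (D : set R) : f @ within D (nbhs t) --> l ->
    exists2 e : R, 0 < e & forall s, D s -> `|t - s| < e -> `|f s| <= `|l| + 1.
  move=> /cvgrPdist_le/(_ 1 ltr01)/near_within_distP[e e0 He].
  exists e => // s Ds /(He s Ds) h; have -> : f s = l - (l - f s) by ring.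
  by apply: (le_trans (ler_normB _ _)); rewrite lerD2l.
have [[Kt st]|nd] := pselect (K t /\ sigma T t = t).
  by have [e e0 He] := dist1 _ _ (fr t Kt st); exists (`|f t| + 1), e.
have [er er0 Her] : exists2 e : R, 0 < e &
    forall s, K s -> `|t - s| < e -> s <= t.
  case: (lt_max_or_eq Tt) => [tb|->]; last first.
    by exists 1 => // s /kappa_sub/T_le.
  have : t < sigma T t.
    rewrite lt_neqAle sigma_ge // andbT eq_sym; apply/eqP => st.
    by apply: nd; split => //; exact: kappa_lt.
  move=> /(right_scattered_near Tt)[e e0 H].
  by exists e => // s /kappa_sub; exact: H.
have [M [el [el0 Hel]]] : exists M e : R, 0 < e /\
    forall s, K s -> s < t -> `|t - s| < e -> `|f s| <= M.
  have [ta|at_] := leP t a.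
    by exists 0, 1; split => // s /kappa_sub/T_ge; lra.
  have := rho_le at_; rewrite le_eqVlt => /predU1P[rt|rt]; last first.
    exists 0, (t - rho T t); split; first by lra.
    move=> s /kappa_sub Ts st; have := rho_ge Ts st.
    rewrite gtr0_norm; lra.
  have Kt : K t.
    by split => // -[_]; rewrite /left_scattered rt ltxx.
  have [l fl'] := fl t Kt ((left_denseP t).2 (conj at_ rt)).
  have [e e0 He] := dist1 _ _ fl'.
  by exists (`|l| + 1), e; split => // s Ks st; exact: He.
exists (Num.max M `|f t|), (Num.min er el); split; first by rewrite lt_min er0.
move=> s Ks; rewrite lt_min le_max => /andP[sr sl].
have := Her s Ks sr; rewrite le_eqVlt => /predU1P[->|st].
  by rewrite lexx orbT.
by rewrite Hel.
Qed.

Lemma rd_cont_bounded f : rd_cont f ->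
  exists2 M : R, 0 < M & forall t, K t -> `|f t| <= M.
Proof.
move=> rf; have /compact_near_coveringP cov := compactT.
have [M [_ HM]] : \forall M \near +oo, T `<=` [set t | K t -> `|f t| <= M].
  apply: cov => t Tt; have [M [e [e0 He]]] := rd_cont_local_bound rf Tt.
  exists (ball t e, [set x | M < x]) => /=.
    by split; [exact: nbhsx_ballx|exact: nbhs_pinfty_gt (num_real M)].
  by move=> [s N] /= [/(He s) h MN] Ks; apply: le_trans (h Ks) (ltW MN).
exists (Num.max 1 (M + 1)); first by rewrite lt_max ltr01.
move=> t Kt; apply: HM => //; last exact: kappa_sub.
by rewrite lt_max ltrDl ltr01 orbT.
Qed.

(** The largest subsolution.  Among the functions z with z a = 0 whose increment
    over each [u, v] is at most (v - u) times every upper bound of f on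
    [u, v[, take the supremum of the values at t.  The upper estimate
    passes to the supremum; for the lower one, a subsolution up to s is
    continued from s to t with slope lo.  In effect xi is the upper Darboux
    integral of f over [a, t]. *)
Lemma interval_integral (f : R -> R) (M : R) :
  (forall t, K t -> `|f t| <= M) ->
  exists xi : R -> R, forall s t lo hi, T s -> T t -> s <= t ->
    (forall w, T w -> s <= w < t -> lo <= f w <= hi) ->
    lo * (t - s) <= xi t - xi s <= hi * (t - s).
Proof.
move=> fM.
have {}fM w v : T w -> T v -> w < v -> - M <= f w <= M.
  move=> Tw Tv wv; rewrite -ler_norml; apply: fM; apply: kappa_lt => //.
  exact: lt_le_trans wv (T_le Tv).
pose sub t (z : R -> R) := z a = 0 /\ forall u v m, T u -> T v -> u <= v ->
  v <= t -> (forall w, T w -> u <= w < v -> f w <= m) ->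
  z v - z u <= m * (v - u).
pose V t := [set z t | z in sub t].
pose xi t := sup (V t).
have Ta : T a by case: ha.
have V_sup t : T t -> has_sup (V t).
  move=> Tt; split.
    exists (- M * (t - a)), (fun r => - M * (r - a)) => //.
    split; first by rewrite subrr mulr0.
    move=> u v m Tu Tv; rewrite le_eqVlt => /predU1P[->|uv] _ fm.
      by rewrite !subrr mulr0.
    have := fm u Tu; rewrite lexx uv => /(_ isT).
    have /andP[h _] := fM u v Tu Tv uv => h'.
    have : - M * (v - u) <= m * (v - u) by apply: ler_wpM2r; lra.
    lra.
  exists (M * (t - a)) => _ [z [za zs] <-].
  rewrite -[z t]subr0 -za; apply: zs => //; first exact: T_ge.
  by move=> w Tw /andP[_ wt]; have /andP[] := fM w t Tw Tt wt.
exists xi => s t lo hi Ts Tt; rewrite le_eqVlt => /predU1P[->|st] Hf.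
  by rewrite !subrr !mulr0 lexx.
apply/andP; split.
  rewrite lerBrDr -lerBrDl; apply: ge_sup (V_sup s Ts).1 _ => _ [z [za zs] <-].
  rewrite lerBrDl; apply: ub_le_sup (V_sup t Tt).2 _ _.
  exists (fun r => if r <= s then z r else z s + lo * (r - s)); last first.
    by rewrite leNgt st /= addrC.
  split; first by rewrite T_ge.
  move=> u v m Tu Tv uv vt fm.
  have [vs|sv] := leP v s; first by rewrite (le_trans uv vs); exact: zs.
  have lof : lo <= f s.
    by move: (Hf s Ts); rewrite lexx st => /(_ isT)/andP[].
  have [us|su] := leP u s.
    have fsm : f s <= m by apply: fm => //; rewrite us.
    have : z s - z u <= m * (s - u).
      apply: zs => // w Tw /andP[uw ws]; apply: fm => //.
      by rewrite uw (lt_trans ws sv).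
    have : lo * (v - s) <= m * (v - s) by apply: ler_wpM2r; lra.
    lra.
  move: uv; rewrite le_eqVlt => /predU1P[->|uv].
    by rewrite !subrr mulr0.
  have h1 : lo <= f u.
    by move: (Hf u Tu); rewrite (ltW su) (lt_le_trans uv vt) => /(_ isT)/andP[].
  have h2 : f u <= m by apply: fm => //; rewrite lexx.
  have : lo * (v - u) <= m * (v - u) by apply: ler_wpM2r; lra.
  lra.
rewrite lerBlDr; apply: ge_sup (V_sup t Tt).1 _ => _ [z [za zs] <-].
rewrite -lerBlDl; apply: le_trans (_ : z s <= _).
  have : z t - z s <= hi * (t - s).
    by apply: zs => // [|w Tw wst]; [exact: ltW|have /andP[] := Hf w Tw wst].
  lra.
apply: ub_le_sup (V_sup s Ts).2 _ _; exists z => //; split => //.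
by move=> u v m Tu Tv uv vs; apply: zs => //; exact: le_trans vs (ltW st).
Qed.

(** At a point fixed by sigma, continuity puts f within eps of f t on a
    neighbourhood, and interval_integral gives the difference quotients.  At a
    right-scattered t, the increment over [t, sigma t] is exactly
    f t * (sigma t - t), and xi is Lipschitz on the left of t. *)
Lemma rd_cont_antideriv f : rd_cont f ->
  exists xi, is_delta_antideriv T f xi.
Proof.
move=> rf; have [M M0 fM] := rd_cont_bounded rf.
have [xi Hxi] := interval_integral fM.
exists xi => t Kt eps eps0; have Tt := kappa_sub Kt; apply/near_within_distP.
have := sigma_ge Tt; rewrite le_eqVlt => /predU1P[/esym st|ts].
  have /cvgrPdist_le/(_ eps eps0)/near_within_distP[e e0 He] := rf.1 t Kt st.
  exists e => // s Ts tse; rewrite st.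
  have [s_t|ts] := leP s t.
    have /andP[] :
        (f t - eps) * (t - s) <= xi t - xi s <= (f t + eps) * (t - s).
      apply: Hxi => // w Tw /andP[sw wt].
      have Kw : K w by apply: kappa_lt => //; exact: lt_le_trans wt (T_le Tt).
      have := He w Kw; rewrite gtr0_norm; last by lra.
      rewrite ger0_norm in tse; last by lra.
      have -> : t - w < e by lra.
      by move=> /(_ isT); rewrite ler_norml => /andP[]; lra.
    rewrite [in eps * _]ger0_norm; last by lra.
    rewrite ler_norml; lra.
  have /andP[] : (f t - eps) * (s - t) <= xi s - xi t <= (f t + eps) * (s - t).
    apply: Hxi => //; first exact: ltW.
    move=> w Tw /andP[tw ws].
    have Kw : K w by apply: kappa_lt => //; exact: lt_le_trans ws (T_le Ts).
    have := He w Kw; rewrite ler0_norm; last by lra.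
    rewrite ltr0_norm in tse; last by lra.
    have -> : - (t - w) < e by lra.
    by move=> /(_ isT); rewrite ler_norml => /andP[]; lra.
  rewrite [in eps * _]ltr0_norm; last by lra.
  rewrite ler_norml; lra.
have Tst := sigma_in Tt; set st := sigma T t in ts Tst *.
have jump : xi st - xi t = f t * (st - t).
  suff : f t * (st - t) <= xi st - xi t <= f t * (st - t) by move/le_anti.
  apply: Hxi => //; first exact: ltW.
  move=> w Tw; rewrite le_eqVlt => /andP[/predU1P[<-|tw] ws].
    by rewrite lexx.
  by have := sigma_le Tw tw; rewrite -/st; lra.
have [e e0 He] := right_scattered_near Tt ts.
pose h := eps * (st - t) / (2 * M).
have h0 : 0 < h by apply: divr_gt0; [apply: mulr_gt0 => //; lra|lra].
have hE : h * (2 * M) = eps * (st - t) by rewrite /h divfK //; apply/eqP; lra.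
exists (Num.min e h); first by rewrite lt_min e0.
move=> s Ts; rewrite lt_min => /andP[/(He s Ts) le_st].
rewrite ger0_norm; last by lra.
move=> tsh.
have /andP[h1 h2] : - M * (t - s) <= xi t - xi s <= M * (t - s).
  apply: Hxi => // w Tw /andP[_ wt]; rewrite -ler_norml; apply: fM.
  by apply: kappa_lt => //; exact: lt_le_trans wt (T_le Tt).
rewrite (gtr0_norm (_ : 0 < st - s)); last by lra.
have -> : xi st - xi s = f t * (st - t) + (xi t - xi s) by lra.
have : (t - s) * (2 * M) <= h * (2 * M) by apply: ler_wpM2r; lra.
have : 0 <= eps * (t - s) by apply: mulr_ge0; lra.
have := fM t Kt; rewrite ler_norml => /andP[f1 f2].
have : f t * (t - s) <= M * (t - s) by apply: ler_wpM2r; lra.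
have : - M * (t - s) <= f t * (t - s) by apply: ler_wpM2r; lra.
rewrite ler_norml; lra.
Qed.

(** * Stability of rd-continuity *)

Lemma rd_cont_ext f g : rd_cont f -> {in K, f =1 g} -> rd_cont g.
Proof.
move=> [fr fl] fg.
have tr (D : set R) (t l : R) : D `<=` K -> f @ within D (nbhs t) --> l ->
    g @ within D (nbhs t) --> l.
  move=> DK /cvgrPdist_le fl'; apply/cvgrPdist_le => e e0.
  move: (fl' e e0) => /near_within_distP[h h0 H]; apply/near_within_distP.
  by exists h => // s Ds; rewrite -fg ?inE; [exact: H|exact: DK].
split => [t Kt st|t Kt dt].
  by rewrite -fg ?inE //; apply: tr => //; exact: fr.
by have [l fl'] := fl t Kt dt; exists l; apply: tr fl' => s [].
Qed.

Lemma rd_cont_continuous (f : R -> R) :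
  (forall t, T t -> f @ within T (nbhs t) --> f t) -> rd_cont f.
Proof.
move=> fc; have sub (D : set R) (t : R) : D `<=` T -> T t ->
    f @ within D (nbhs t) --> f t.
  move=> DT Tt; apply: cvg_trans (fc t Tt); apply: cvg_app.
  exact: within_subset.
split => [t Kt _|t Kt _]; first by apply: sub => // [s|]; exact: kappa_sub.
by exists (f t); apply: sub => // [s [/kappa_sub]|]//; exact: kappa_sub.
Qed.

Lemma rd_cont_comp (Phi : R -> R -> R -> R) (x y : R -> R) :
  {within `[a, b] `*` setT `*` setT,
    continuous (fun p : R * R * R => Phi p.1.1 p.1.2 p.2)} ->
  rd_cont x -> rd_cont y -> rd_cont (fun t => Phi t (x t) (y t)).
Proof.
move=> cPhi [xr xl] [yr yl].
have /subspace_continuousP {}cPhi := cPhi.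
have tr (D : set R) (t lx ly : R) : D `<=` K -> T t ->
    x @ within D (nbhs t) --> lx -> y @ within D (nbhs t) --> ly ->
    (fun t => Phi t (x t) (y t)) @ within D (nbhs t) --> Phi t lx ly.
  move=> DK Tt cx cy.
  have tab s : T s -> s \in `[a, b] by move=> Ts; rewrite in_itv /= T_ge ?T_le.
  have cp : (fun s => (s, x s, y s)) @ within D (nbhs t) -->
      nbhs (t, lx, ly).
    have cid : (fun s : R => s) @ within D (nbhs t) --> t by exact: cvg_within.
    exact: cvg_pair (cvg_pair cid cx) cy.
  have inD (s r q : R) : T s -> (`[a, b] `*` setT `*` setT) (s, r, q).
    by move=> Ts; split => //; split => //=; exact: tab.
  have {}cp : (fun s => (s, x s, y s)) @ within D (nbhs t) -->
      within (`[a, b] `*` setT `*` setT) (nbhs (t, lx, ly)).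
    move=> U /= UD; have /near_within_distP[e e0 He] := cp _ UD.
    apply/near_within_distP; exists e => // s Ds ts; apply: (He s Ds ts).
    by apply: inD; apply: kappa_sub; exact: DK.
  have cq := cPhi (t, lx, ly) (inD _ _ _ Tt).
  by move=> U /cq; exact: cp.
split => [t Kt st|t Kt dt].
  by apply: tr => //; [exact: kappa_sub|exact: xr|exact: yr].
have [lx hx] := xl t Kt dt; have [ly hy] := yl t Kt dt.
by exists (Phi t lx ly); apply: (tr _ _ _ _ _ (kappa_sub Kt)) => // s [].
Qed.

(** Squeezing: sigma s lies between s and t when s < t, and when t is
    right-dense sigma s <= u for any point u of T above s. *)
Lemma rd_cont_sigma (f : R -> R) :
  (forall t, T t -> f @ within T (nbhs t) --> f t) -> rd_cont (f \o sigma T).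
Proof.
move=> fc.
have tr (D : set R) (t : R) : D `<=` T -> T t ->
    (forall e : R, 0 < e -> exists2 h : R, 0 < h &
       forall s, D s -> `|t - s| < h -> `|t - sigma T s| < e) ->
    (f \o sigma T) @ within D (nbhs t) --> f t.
  move=> DT Tt H; apply: cvg_comp (fc t Tt) => U [e /= e0 He].
  have [h h0 Hh] := H e e0; exists h => // s /= sh Ds; apply: He => /=.
    exact: Hh.
  by apply: sigma_in; exact: DT.
have leftc t e s : T t -> T s -> s < t -> `|t - s| < e -> `|t - sigma T s| < e.
  move=> Tt Ts st; have h1 := sigma_ge Ts; have h2 := sigma_le Tt st.
  by rewrite !ger0_norm; lra.
split => [t Kt st|t Kt _]; have Tt := kappa_sub Kt.
  rewrite /= st; apply: tr => //; first exact: kappa_sub.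
  move=> e e0; case: (lt_max_or_eq Tt) => [tb|tb]; last first.
    exists e => // s /kappa_sub Ts; case: (lt_max_or_eq Ts) => [sb|->].
      by apply: leftc => //; rewrite tb.
    by rewrite sigma_max.
  have [u [Tu tu ue]] := right_approx tb st e0.
  exists (Num.min e (u - t)); first by rewrite lt_min e0; lra.
  move=> s /kappa_sub Ts; rewrite lt_min => /andP[se su].
  have [s_t|ts] := ltP s t; first exact: leftc.
  have us : s < u by move: su; rewrite ler0_norm; lra.
  have h1 := sigma_le Tu us; have h2 := sigma_ge Ts.
  by rewrite ler0_norm; lra.
exists (f t); apply: tr => // [s [/kappa_sub]|e e0] //.
by exists e => // s [/kappa_sub Ts /= s_t]; exact: leftc.
Qed.

(** * Continuously delta differentiable functions *)

Lemma C1rd_antideriv x : C1rd T x -> is_delta_antideriv T (delta_deriv T x) x.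
Proof.
move=> [dx _] t Kt; have [d xd] := dx t Kt.
by apply: (@xgetPex _ 0 [set d | is_delta_deriv T x t d]); exists d.
Qed.

(** Only the continuity at a left-dense maximum needs an argument: by the mean
    value inequality, the derivative there is the left limit of the
    derivatives. *)
Lemma C1rd_deriv_rd_cont x : C1rd T x -> rd_cont (delta_deriv T x).
Proof.
move=> Cx; have dx := C1rd_antideriv Cx; case: Cx => _ [xr xl].
set x' := delta_deriv T x in dx xr xl *.
split => // t Kt st; have Tt := kappa_sub Kt.
case: (lt_max_or_eq Tt) => [tb|tb]; first exact/xr/right_dense_sigma.
rewrite {}tb {st} in Kt Tt *.
have rb := kappa_max Kt.
have [l /cvgrPdist_le xl'] := xl b Kt ((left_denseP b).2 (conj ab rb)).
suff lE : l = x' b.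
  apply/cvgrPdist_le => e e0; have /near_within_distP[h h0 H] := xl' e e0.
  apply/near_within_distP; exists h => // s Ks sh.
  case: (lt_max_or_eq (kappa_sub Ks)) => [sb|->]; last first.
    by rewrite subrr normr0 ltW.
  by rewrite -lE; exact: H.
apply/eqP; rewrite -subr_eq0 -normr_le0.
apply/ler_addgt0Pl => e e0; rewrite addr0.
have e20 : 0 < e / 2 by lra.
have /near_within_distP[h h0 Hl] := xl' _ e20.
have /near_within_distP[k k0 Hd] := dx b Kt _ e20.
have hk : 0 < Num.min h k by rewrite lt_min h0.
have [s [Ts sb]] := left_approx ab rb hk.
rewrite ltrBlDr -ltrBlDl lt_min => /andP[sh sk].
have Hw w : T w -> s <= w < b -> `|l - x' w| <= e / 2.
  move=> Tw /andP[sw wb]; apply: Hl; last by rewrite gtr0_norm; lra.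
  by split => //; exact: kappa_lt.
have up : x b - x s <= (l + e / 2) * b - (l + e / 2) * s.
  apply: (antideriv_le dx (antideriv_cst (l + e / 2))) => //; first exact: ltW.
  by move=> w Tw sw; have := Hw w Tw sw; rewrite ler_norml => /andP[]; lra.
have lo : (l - e / 2) * b - (l - e / 2) * s <= x b - x s.
  apply: (antideriv_le (antideriv_cst (l - e / 2)) dx) => //; first exact: ltW.
  by move=> w Tw sw; have := Hw w Tw sw; rewrite ler_norml => /andP[]; lra.
have := Hd s Ts; rewrite sigma_max gtr0_norm; last by lra.
move=> /(_ sk); rewrite ler_norml => /andP[h1 h2].
have sb0 : 0 < b - s by lra.
rewrite -(ler_pM2r sb0) -{1}(gtr0_norm sb0) -normrM ler_norml; lra.
Qed.

Lemma antideriv_C1rd f F : rd_cont f -> is_delta_antideriv T f F ->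
  C1rd T F /\ {in K, delta_deriv T F =1 f}.
Proof.
move=> rf FF; have E : {in K, delta_deriv T F =1 f}.
  by move=> t; rewrite inE => Kt; exact: delta_derivE (FF t Kt).
split => //; split; first by move=> t Kt; exists (f t); exact: FF.
have [fr fl] : rd_cont (delta_deriv T F).
  by apply: (rd_cont_ext rf) => t Kt; rewrite E.
by split => // t Kt [_ st]; exact: fr.
Qed.

Lemma antideriv_shift f F k : is_delta_antideriv T f F ->
  is_delta_antideriv T f (fun t => F t + k).
Proof.
move=> FF t Kt e e0; apply: filterS (FF t Kt e e0) => s.
by congr (`|_ - _| <= _); ring.
Qed.

Lemma antideriv_norm_le f F C c d : is_delta_antideriv T f F ->
  (forall t, K t -> `|f t| <= C) -> T c -> T d -> c <= d ->
  `|F d - F c| <= C * (d - c).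
Proof.
move=> FF fC Tc Td cd.
have fC' t : T t -> c <= t < d -> - C <= f t <= C.
  move=> Tt /andP[_ td]; rewrite -ler_norml; apply/fC/kappa_lt => //.
  exact: lt_le_trans td (T_le Td).
have up : F d - F c <= C * d - C * c.
  by apply: (antideriv_le FF (antideriv_cst C)) => // t Tt /(fC' t Tt)/andP[].
have lo : - C * d - - C * c <= F d - F c.
  apply: (antideriv_le (antideriv_cst (- C)) FF) => // t Tt.
  by move=> /(fC' t Tt)/andP[].
rewrite ler_norml; lra.
Qed.

Lemma antideriv_rd_cont f F : is_delta_antideriv T f F -> rd_cont F.
Proof.
by move=> FF; apply: rd_cont_continuous => t; exact: antideriv_cont FF.
Qed.

Lemma rd_cont_lin f g k : rd_cont f -> rd_cont g ->
  rd_cont (fun t => f t + k * g t).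
Proof.
move=> [fr fl] [gr gl]; split => [t Kt st|t Kt dt].
  exact: (cvgD (fr t Kt st) (cvgM (cvg_cst k) (gr t Kt st))).
have [l Hl] := fl t Kt dt; have [m Hm] := gl t Kt dt.
by exists (l + k * m); exact: (cvgD Hl (cvgM (cvg_cst k) Hm)).
Qed.

Lemma rd_cont_sqr f : rd_cont f -> rd_cont (fun t => f t * f t).
Proof.
move=> [fr fl]; split => [t Kt st|t Kt dt].
  exact: (cvgM (fr t Kt st) (fr t Kt st)).
by have [l cl] := fl t Kt dt; exists (l * l); exact: (cvgM cl cl).
Qed.

Lemma rd_cont_cst k : rd_cont (fun=> k).
Proof. by apply: rd_cont_continuous => t _; exact: cvg_cst. Qed.

(** The antiderivative F is nondecreasing with equal end values, hence constant,
    and the derivative of a constant is zero at every point where delta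
    derivatives are unique. *)
Lemma antideriv_ge0_eq0 f F : is_delta_antideriv T f F ->
  (forall t, 0 <= f t) -> F b = F a -> forall t, K t -> f t = 0.
Proof.
move=> FF f0 Fab t Kt.
have Fa s : T s -> F s = F a.
  move=> Ts; apply/le_anti/andP; split.
    rewrite -Fab; apply: (antideriv_nondecr FF) => //; last exact: T_le.
    by case: hb.
  by apply: (antideriv_nondecr FF) => //; [case: ha|exact: T_ge].
apply: (delta_deriv_uniq Kt (FF t Kt)) => e e0; apply/near_within_distP.
exists 1 => // s Ts _; rewrite !Fa //; last by apply: sigma_in; case: Kt.
by rewrite subrr mul0r subr0 normr0 mulr_ge0 // ltW.
Qed.

(** * The first variation *)

Variable L : R -> R -> R -> R.
Hypothesis hL : C1_lagrangian a b L.

Local Notation J := (functional T a b L).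

Lemma lagrangian_rd_cont x x' : rd_cont x -> rd_cont x' ->
  rd_cont (fun t => L t (x t) (x' t)).
Proof. exact/rd_cont_comp/lagrangian_continuous. Qed.

(** I b - I a is the directional derivative of the functional at x along eta:
    integrating lagrangian_expansion leaves an error bounded by e * `|k|. *)
Lemma functional_expansion (x eta eta' I : R -> R) (e : R) :
  C1rd T x -> rd_cont eta' -> is_delta_antideriv T eta' eta ->
  is_delta_antideriv T (fun t =>
    partial2 L t (x t) (delta_deriv T x t) * eta t +
    partial3 L t (x t) (delta_deriv T x t) * eta' t) I ->
  0 < e ->
  exists2 h : R, 0 < h & forall k, `|k| < h ->
    `|J (fun t => x t + k * eta t) - J x - k * (I b - I a)| <= e * `|k|.
Proof.
move=> Cx reta' deta dI e0.
have dx := C1rd_antideriv Cx; have rx' := C1rd_deriv_rd_cont Cx.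
set x' := delta_deriv T x in dx rx' dI *.
have rx := antideriv_rd_cont dx; have reta := antideriv_rd_cont deta.
have [M1 M10 xM] := rd_cont_bounded rx.
have [M2 M20 x'M] := rd_cont_bounded rx'.
have [B1 B10 etaB] := rd_cont_bounded reta.
have [B2 B20 eta'B] := rd_cont_bounded reta'.
pose B := B1 + B2; have B0 : 0 < B by rewrite /B; lra.
(* The integrated error is e' * (`|k| * B) * (b - a) = e * `|k|. *)
pose e' := e / (B * (b - a)).
have Bab : 0 < B * (b - a) by rewrite mulr_gt0 // subr_gt0.
have e'0 : 0 < e' by apply: divr_gt0.
have e'E : e' * (B * (b - a)) = e by rewrite /e' divfK // gt_eqF.
have [h h0 Hh] := lagrangian_expansion hL (M1 + M2) e'0.
have hB : (h / B) * B = h by rewrite divfK // gt_eqF.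
exists (h / B); first exact: divr_gt0.
move=> k kh; have k0 := normr_ge0 k.
have kB : `|k| * B < h by rewrite -hB ltr_pM2r.
have dy : is_delta_antideriv T (fun t => x' t + k * eta' t)
    (fun t => x t + k * eta t).
  exact: antideriv_lin.
have [Cy y'E] := antideriv_C1rd (rd_cont_lin k rx' reta') dy.
set y := fun t => x t + k * eta t in dy Cy y'E *.
have ry' := C1rd_deriv_rd_cont Cy.
have [Y dY] := rd_cont_antideriv
  (lagrangian_rd_cont (antideriv_rd_cont dy) ry').
have [X dX] := rd_cont_antideriv (lagrangian_rd_cont rx rx').
have Ta : T a by case: ha.
have Tb : T b by case: hb.
rewrite /functional (delta_intE dY) // (delta_intE dX) //.
have dZ := antideriv_lin (- k) (antideriv_lin (-1) dY dX) dI.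
have : `|Y b + -1 * X b + - k * I b - (Y a + -1 * X a + - k * I a)|
    <= e' * (`|k| * B) * (b - a).
  apply: (antideriv_norm_le dZ) => // [t Kt|]; last exact: ltW.
  rewrite y'E ?inE // -/x' /y.
  have tab : a <= t <= b by rewrite T_ge ?T_le //; exact: kappa_sub.
  have E1 := etaB t Kt; have E2 := eta'B t Kt.
  have k1 : `|k| * `|eta t| <= `|k| * B1 by apply: ler_wpM2l.
  have k2 : `|k| * `|eta' t| <= `|k| * B2 by apply: ler_wpM2l.
  have k3 : 0 <= `|k| * B1 by apply: mulr_ge0 => //; lra.
  have k4 : 0 <= `|k| * B2 by apply: mulr_ge0 => //; lra.
  have kBE : `|k| * B = `|k| * B1 + `|k| * B2 by rewrite /B mulrDr.
  have := Hh t (x t) (x' t) (k * eta t) (k * eta' t) tab; rewrite !normrM.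
  have -> : `|x t| <= M1 + M2 by have := xM t Kt; lra.
  have -> : `|x' t| <= M1 + M2 by have := x'M t Kt; lra.
  have -> : `|k| * `|eta t| < h by lra.
  have -> : `|k| * `|eta' t| < h by lra.
  move=> /(_ isT isT isT isT) H.
  have H' : e' * (`|k| * `|eta t| + `|k| * `|eta' t|) <= e' * (`|k| * B).
    by apply: ler_wpM2l; lra.
  apply: le_trans H'; apply: le_trans H.
  by rewrite le_eqVlt; apply/orP; left; apply/eqP; congr `|_|; ring.
have -> : e' * (`|k| * B) * (b - a) = e * `|k| by rewrite -[in RHS]e'E; ring.
by congr (`|_| <= _); ring.
Qed.

Lemma C1_distance_perturb (x eta eta' : R -> R) (k B : R) :
  C1rd T x -> rd_cont eta' -> is_delta_antideriv T eta' eta ->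
  (forall t, T t -> `|eta t| <= B) -> (forall t, K t -> `|eta' t| <= B) ->
  (C1_distance T (fun t => x t + k * eta t)%R x <= (`|k| * B + `|k| * B)%:E)%E.
Proof.
move=> Cx reta' deta etaB eta'B.
have dx := C1rd_antideriv Cx; have rx' := C1rd_deriv_rd_cont Cx.
have [_ y'E] :=
  antideriv_C1rd (rd_cont_lin k rx' reta') (antideriv_lin k dx deta).
rewrite EFinD; apply: leeD; apply/ereal_supP => _ [t Tt <-]; rewrite lee_fin.
  have -> : x t + k * eta t - x t = k * eta t by ring.
  by rewrite normrM; apply: ler_wpM2l => //; exact: etaB.
rewrite y'E ?inE //.
have -> : delta_deriv T x t + k * eta' t - delta_deriv T x t = k * eta' t.
  by ring.
by rewrite normrM; apply: ler_wpM2l => //; exact: eta'B.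
Qed.

(** With s = 1 at a minimizer and s = -1 at a maximizer, s (J y - J x) >= 0 for
    all y near x.  Taking y = x + l eta with l = s k and l = - s k bounds
    I b - I a on both sides by the error of functional_expansion. *)
Lemma first_variation (xa xb : R) (x eta eta' I : R -> R) :
  local_minimizer T a b xa xb J x \/ local_maximizer T a b xa xb J x ->
  rd_cont eta' -> is_delta_antideriv T eta' eta -> eta a = 0 -> eta b = 0 ->
  is_delta_antideriv T (fun t =>
    partial2 L t (x t) (delta_deriv T x t) * eta t +
    partial3 L t (x t) (delta_deriv T x t) * eta' t) I ->
  I b = I a.
Proof.
move=> opt reta' deta eta_a eta_b dI.
have [s [s1 [[Cx xa_ xb_] [d d0 Hd]]]] : exists s : R, s * s = 1 /\
    admissible T a b xa xb x /\ exists2 d : R, 0 < d &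
    forall y, admissible T a b xa xb y -> (C1_distance T y x < d%:E)%E ->
      0 <= s * (J y - J x).
  case: opt => -[ax [d d0 H]].
    exists 1; rewrite mulr1; split => //; split => //; exists d => // y ay yd.
    by rewrite mul1r subr_ge0; exact: H.
  exists (-1); rewrite mulrNN mulr1; split => //; split => //.
  exists d => // y ay yd.
  by rewrite mulN1r opprB subr_ge0; exact: H.
have [B1 B10 etaB] := rd_cont_bounded (antideriv_rd_cont deta).
have [B2 B20 eta'B] := rd_cont_bounded reta'.
pose B := B1 + B2; have B0 : 0 < B by rewrite /B; lra.
have ns : `|s| = 1.
  by apply/eqP; rewrite -(@pexpr_eq1 _ _ 2) // -normrX expr2 s1 normr1.
apply/eqP; rewrite -subr_eq0 -normr_le0.
apply/ler_addgt0Pl => e e0; rewrite addr0.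
have [h h0 Hh] := functional_expansion Cx reta' deta dI e0.
pose k := Num.min (h / 2) (d / (4 * B)).
have k0 : 0 < k by rewrite lt_min divr_gt0 //= divr_gt0 //; lra.
have kh : k < h by rewrite gt_min; apply/orP; left; lra.
have kB : k * B + k * B < d.
  have : k <= d / (4 * B) by rewrite ge_min lexx orbT.
  rewrite ler_pdivlMr; lra.
have key l : `|l| = k -> - (s * l * (I b - I a)) <= e * k.
  move=> lk; have := Hh l; rewrite lk => /(_ kh).
  set y := fun t => x t + l * eta t.
  have dx := C1rd_antideriv Cx.
  have [Cy _] := antideriv_C1rd (rd_cont_lin l (C1rd_deriv_rd_cont Cx) reta')
    (antideriv_lin l dx deta).
  have ay : admissible T a b xa xb y.
    by split => //; rewrite /y ?eta_a ?eta_b mulr0 addr0.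
  have := Hd y ay; have -> : (C1_distance T y x < d%:E)%E.
    apply: (@le_lt_trans _ _ (`|l| * B + `|l| * B)%:E); last first.
      by rewrite lte_fin lk.
    apply: C1_distance_perturb Cx reta' deta _ _ => t Tt.
      have [Kt|nK] := pselect (K t).
        by have := etaB t Kt; rewrite /B; lra.
      case: (lt_max_or_eq Tt) => [/(kappa_lt Tt)//|->].
      by rewrite eta_b normr0 ltW.
    by have := eta'B t Tt; rewrite /B; lra.
  move=> /(_ isT) Hs H.
  set Dl := J y - J x in Hs H.
  have : `|s * (Dl - l * (I b - I a))| <= e * k by rewrite normrM ns mul1r.
  by rewrite ler_norml => /andP[_]; lra.
have := key (s * k); rewrite normrM ns mul1r gtr0_norm // => /(_ erefl).
have := key (- s * k).
rewrite normrM normrN ns mul1r gtr0_norm // => /(_ erefl).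
rewrite !mulrA mulrN s1 mul1r mulN1r => h1 h2.
rewrite -(ler_pM2r k0) -{1}(gtr0_norm k0) -normrM ler_norml; lra.
Qed.

(** * The Euler-Lagrange equation in integral form *)

(** In the proof, eta is the antiderivative of eta' = g - c with eta a = 0, and
    W one of (g - c)^2; W + c eta + P eta is then an antiderivative of the first
    variation along eta. *)
Lemma euler_lagrange (xa xb : R) (x : R -> R) : C1rd T x ->
  local_minimizer T a b xa xb J x \/ local_maximizer T a b xa xb J x ->
  exists c : R, forall t : R, K t ->
    partial3 L t (x t) (delta_deriv T x t) =
    delta_int T (fun tau => partial2 L tau (x tau) (delta_deriv T x tau))
      a (sigma T t) + c.
Proof.
move=> Cx opt; have [_ _ c2 c3] := hL.
have rx := antideriv_rd_cont (C1rd_antideriv Cx).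
have rx' := C1rd_deriv_rd_cont Cx.
set x' := delta_deriv T x in rx' *.
pose p t := partial2 L t (x t) (x' t); pose q t := partial3 L t (x t) (x' t).
have rp : rd_cont p := rd_cont_comp c2 rx rx'.
have rq : rd_cont q := rd_cont_comp c3 rx rx'.
have [P dP] := rd_cont_antideriv rp.
have rg :=
  rd_cont_lin (-1) rq (rd_cont_sigma (fun t => antideriv_cont dP (t:=t))).
have [G dG] := rd_cont_antideriv rg.
pose c := (G b - G a) / (b - a).
have cE : c * (b - a) = G b - G a by rewrite /c divfK // subr_eq0 gt_eqF.
have deta :=
  antideriv_shift (c * a - G a) (antideriv_lin (-1) dG (antideriv_cst c)).
have reta' := rd_cont_lin (-1) rg (rd_cont_cst c).
set eta' := (fun t => q t + _ + _) in deta reta'.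
set eta := (fun t => G t + _ + _) in deta.
have [W dW] := rd_cont_antideriv (rd_cont_sqr reta').
have eta_a : eta a = 0 by rewrite /eta; ring.
have eta_b : eta b = 0 by rewrite /eta; lra.
have dI : is_delta_antideriv T (fun t => p t * eta t + q t * eta' t)
    (fun t => W t + c * eta t + 1 * (P t * eta t)).
  move=> t Kt.
  have := is_delta_deriv_lin 1 (is_delta_deriv_lin c (dW t Kt) (deta t Kt))
    (is_delta_deriv_mul (kappa_sub Kt) (dP t Kt) (deta t Kt)).
  by congr is_delta_deriv; rewrite /eta' /=; ring.
have := first_variation opt reta' deta eta_a eta_b dI.
rewrite eta_a eta_b !(mulr0, addr0) => Wab.
have eta'0 := antideriv_ge0_eq0 dW (fun t => sqr_ge0 (eta' t)) Wab.
have Ta : T a by case: ha.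
exists (c + P a) => t Kt; rewrite (delta_intE dP) //; last first.
  exact/sigma_in/kappa_sub.
have /eqP := eta'0 t Kt; rewrite mulf_eq0 orbb => /eqP.
rewrite /eta' /q /=; lra.
Qed.

End BoundedTimeScale.

Theorem theorem11 (R : realType) (T : set R) (a b : R)
    (hT : time_scale T) (hbnd : bounded_set T)
    (ha : is_min T a) (hb : is_max T b) (hab : a < b)
    (L : R -> R -> R -> R) (hL : C1_lagrangian a b L)
    (xa xb : R) (xh : R -> R) (hxh : C1rd T xh)
    (hopt : local_minimizer T a b xa xb (functional T a b L) xh \/
            local_maximizer T a b xa xb (functional T a b L) xh) :
  exists c : R, forall t : R, kappa T t ->
    partial3 L t (xh t) (delta_deriv T xh t) =
    delta_int T (fun tau => partial2 L tau (xh tau) (delta_deriv T xh tau))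
      a (sigma T t) + c.
Proof. exact: (euler_lagrange hT.2 ha hb hab hL hxh hopt). Qed.
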